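(* Let $q\ge 2$ be an integer and $n$ a positive integer divisible by $q$. \begin{enumerate} \item If $\frac{(q-1)n}{q}$ is even, then there exists $N=N(q)$ such that for every such $n\ge N$, $\chi_Q(\varOmega_n^{(\mathbb{Z}_q)})=n$. \item If both $n$ and $q$ are prime powers, then $\chi_Q(\varOmega_n^{(\mathbb{F}_q)})=n$. \end{enumerate}
   Context: For a finite additive abelian group $\mathbb{G}$ of order $q$ with $q\mid n$, the generalized Hadamard graph $\varOmega_n^{(\mathbb{G})}$ has vertex set $\mathbb{G}^n$, and $x,y$ are adjacent iff every element of $\mathbb{G}$ appears exactly $n/q$ times among the coordinates of $y-x$. $\mathbb{Z}_q$ is the cyclic group of order $q$ and $\mathbb{F}_q$ the additive group of the field with $q$ elements. A quantum homomorphism from a graph $G$ to a graph $H$ is a family of Hermitian matrices $\{P_{v,\alpha}\}\subseteq\mathbb{C}^{k\times k}$ such that for each $v$, $\sum_\alpha P_{v,\alpha}=I$ and $P_{v,\alpha}P_{v,\beta}=\delta_{\alpha\beta}P_{v,\alpha}$, and $P_{u,\alpha}P_{v,\beta}=0$ whenever $u\sim v$ in $G$ and $\alpha,\beta$ non-adjacent in $H$. $\chi_Q(G)$ is the least $r$ with a quantum homomorphism $G\to K_r$. *)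

(* Defs.v *)
From mathcomp Require Import all_boot all_order all_algebra all_field.
From mathcomp Require Import sesquilinear complex.
From mathcomp Require Import reals.

Set Implicit Arguments.
Unset Strict Implicit.
Unset Printing Implicit Defensive.

Import Order.TTheory GRing.Theory Num.Theory.
Local Open Scope ring_scope.

(* A graph is given by its adjacency relation on a finite vertex type. *)

Definition hadamard_graph (G : finZmodType) (n : nat) : rel {ffun 'I_n -> G} :=
  fun x y => [forall g : G, #|[set i | y i - x i == g]| == (n %/ #|G|)%N].

Lemma hadamard_graph_sym (G : finZmodType) (n : nat) :
  symmetric (@hadamard_graph G n).
Proof.
suff imp (x y : {ffun 'I_n -> G}) : hadamard_graph x y -> hadamard_graph y x.
  by move=> x y; apply/idP/idP; apply: imp.
move/forallP => xy; apply/forallP => g; rewrite -(eqP (xy (- g))).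
by apply/eqP/eq_card => i; rewrite !inE -[y i - _]opprB eqr_opp.
Qed.

Lemma hadamard_graph_irrefl (G : finZmodType) (n : nat) :
  (1 < #|G|)%N -> (0 < n)%N -> (#|G| %| n)%N -> irreflexive (@hadamard_graph G n).
Proof.
move=> G_gt1 n_gt0 Gn x; apply/negP => /forallP/(_ 0).
have -> : [set i | x i - x i == 0] = [set: 'I_n].
  by apply/setP => i; rewrite !inE subrr eqxx.
by rewrite cardsT card_ord eqn_leq [(n <= _)%N]leqNgt ltn_Pdiv.
Qed.

Definition complete_graph (r : nat) : rel 'I_r := fun a b => a != b.

(* [P v a] is the matrix P_{v,a}.  Nothing here forces 0 < k; that is required
   where the dimension k is quantified, since for k = 0 every family of
   matrices satisfies these equations. *)
Record is_quantum_homomorphism (R : realType) (V W : finType)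
    (eG : rel V) (eH : rel W) (k : nat) (P : V -> W -> 'M[R[i]]_k) : Prop := {
  qhom_hermitian : forall v a, P v a \is hermsymmx;
  qhom_sum : forall v, \sum_(a : W) P v a = 1%:M;
  qhom_orth : forall v a b, P v a *m P v b = (a == b)%:R *: P v a;
  qhom_edge : forall u v a b, eG u v -> ~~ eH a b -> P u a *m P v b = 0 }.

Definition quantum_homomorphic (R : realType) (V W : finType)
    (eG : rel V) (eH : rel W) : Prop :=
  exists (k : nat) (P : V -> W -> 'M[R[i]]_k),
    (0 < k)%N /\ is_quantum_homomorphism eG eH P.

(* chi_Q(G) = r.  This is stated as a relation because a relation [eG] with
   loops has no quantum colouring, so chi_Q is not total on [rel V]. *)
Definition is_quantum_chromatic_number (R : realType) (V : finType)
    (eG : rel V) (r : nat) : Prop :=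
  quantum_homomorphic R eG (@complete_graph r) /\
  forall s : nat, quantum_homomorphic R eG (@complete_graph s) -> (r <= s)%N.

Definition prime_power (m : nat) : Prop :=
  exists p e : nat, [/\ prime p, (0 < e)%N & m = (p ^ e)%N].

(* Main.v *)
(** A nontrivial character of the group sends the vertices to vectors of roots of unity,
    orthogonal along edges; twisting them by the Fourier basis gives a quantum
    [n]-coloring by rank-one projections.

    For the lower bound, the entries of the matrices of a quantum [s]-coloring form, at
    each vertex, a vector of fixed norm; these vectors are orthogonal along edges and, by
    Cauchy-Schwarz over the colors, have a large sum.  Hence a clique of size [n] gives
    [n <= s]: for prime powers, take the rows of the multiplication table of GF(n) under
    an additive surjection onto the field with [q] elements.

    For Z_q we use the Hoffman bound instead.  With [S] the set of words containing every
    letter [n / q] times, the eigenvalue at the character [a] is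
    [K a = \sum_(s in S) \prod_i chi (a i * s i)], and it suffices that [K a = |S|] or
    [(n - 1) |K a| <= |S|].  The parity assumption makes [K] invariant under adding a
    constant to [a], so that 0 may be taken to be the most frequent letter of [a].  If [a]
    has at most [n / 2 + 1] nonzero letters, sampling without replacement gives a recursion
    on their number [t] that proves the bound.  Otherwise the rearrangements of [a] are at
    least ['C(n, t) >= 2 ^ (n / q) >= (n + 1) ^ (q + 2)] in number, for large [n], and share
    the same value of [K], while by Parseval the sum of all [|K b|^2] is
    [q ^ n |S| <= (n + 1) ^ q |S|^2]. *)
Require Import Defs.
From mathcomp Require Import all_boot all_order all_algebra all_field.
From mathcomp Require Import perm cyclic sesquilinear complex reals zify ring.

Set Implicit Arguments.
Unset Strict Implicit.
Unset Printing Implicit Defensive.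

Import Order.TTheory GRing.Theory Num.Theory VectorInternalTheory.

(** * Words with prescribed letter counts *)

Section Words.
Variables (A : finType) (n : nat).
Implicit Types (s : {ffun 'I_n -> A}) (m : A -> nat).

Definition letter_count s g := #|[set i | s i == g]|.

Definition words m := [set s | [forall g, letter_count s g == m g]].

Lemma wordsP m s : reflect (letter_count s =1 m) (s \in words m).
Proof. by rewrite inE; apply/(iffP forallP) => ms g; apply/eqP/ms. Qed.

Lemma sum_letter_count s : \sum_g letter_count s g = n.
Proof.
rewrite -[RHS]card_ord -sum1_card (partition_big s xpredT) //=.
by apply: eq_bigr => g _; rewrite sum1dep_card.
Qed.

Lemma letter_count_update s i h g :
  letter_count [ffun j => if j == i then h else s j] g + (s i == g) =
  letter_count s g + (h == g).
Proof.
rewrite /letter_count (cardsD1 i) [in RHS](cardsD1 i) !inE ffunE eqxx.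
rewrite [RHS]addnC addnAC -!addnA; do 2!congr (_ + _); apply/eq_card => j.
by rewrite !inE ffunE; case: (j == i).
Qed.

Definition move_letter m g h x :=
  if x == g then (m g).-1 else if x == h then (m h).+1 else m x.

Definition marked_words m g :=
  [set p : {ffun 'I_n -> A} * 'I_n | (p.1 \in words m) && (p.1 p.2 == g)].

Lemma card_marked_words m g : #|marked_words m g| = #|words m| * m g.
Proof.
rewrite -sum1dep_card.
rewrite -(pair_big_dep (mem (words m)) (fun s i => s i == g) (fun _ _ => 1)) /=.
rewrite -sum_nat_const; apply: eq_bigr => s /wordsP <-.
by rewrite sum1dep_card.
Qed.

(* Double counting of the replacements of one occurrence of [g] by [h]. *)
Lemma card_words_move m g h : g != h -> m h < m g ->
  #|words m| <= #|words (move_letter m g h)|.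
Proof.
move=> gh mgh.
suff: #|marked_words m g| <= #|marked_words (move_letter m g h) h|.
  (* The bound reads [#|words m| * m g <= #|words (move_letter m g h)| * (m h).+1], and
     [(m h).+1 <= m g]. *)
  rewrite !card_marked_words {2}/move_letter eq_sym (negPf gh) eqxx => le.
  have mg : 0 < m g by lia.
  by rewrite -(leq_pmul2r mg); apply: leq_trans le _; rewrite leq_mul2l mgh orbT.
pose F (p : {ffun 'I_n -> A} * 'I_n) :=
  ([ffun j => if j == p.2 then h else p.1 j], p.2).
rewrite -(@card_in_imset _ _ F) => [|[s i] [s' i']]; last first.
  rewrite !inE /= => /andP[_ /eqP si] /andP[_ /eqP si'] [/ffunP e ii].
  congr (_, _) => //; apply/ffunP => j; have := e j; rewrite !ffunE ii.
  by case: eqP => // ->; rewrite si' -ii si.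
apply/subset_leq_card/subsetP => _ /imsetP[[s i] + ->].
rewrite !inE /= => /andP[/forallP ms /eqP si]; rewrite ffunE !eqxx andbT.
apply/forallP => x; have := letter_count_update s i h x.
rewrite (eqP (ms x)) si /move_letter.
have [-> |xg] := eqVneq x g; first by rewrite [h == g]eq_sym (negPf gh) addn1 addn0 => <-.
by have [->|_] := eqVneq x h; rewrite !(addn0, addn1) => ->.
Qed.

(** Induction on the total excess over [k]: moving a letter from an overfull [g] to an underfull [h]
    lowers the excess by one and, by [card_words_move], loses no words. *)
Lemma card_words_le_balanced k m :
  \sum_g m g = #|A| * k -> #|words m| <= #|words (fun=> k)|.
Proof.
move: {2}(\sum_g (m g - k)) (leqnn (\sum_g (m g - k))) => d.
elim: d m => [|d IHd] m led sum_m.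
  have mk g : m g <= k.
    by move: led; rewrite leqn0 sum_nat_eq0 => /forallP/(_ g)/=; rewrite subn_eq0.
  suff mE : m =1 fun=> k.
    by rewrite subset_leq_card //; apply/subsetP => s; rewrite !inE => /forallP h;
       apply/forallP => g; rewrite -(mE g).
  move=> g; apply/eqP; rewrite eqn_leq mk leqNgt; apply/negP => ltk.
  suff : \sum_g m g < \sum_(g : A) k by rewrite sum_m sum_nat_const ltnn.
  rewrite (bigD1 g) // [ltnRHS](bigD1 g) //= -addSn leq_add //.
  by apply: leq_sum.
have [/existsP[g gk]|/existsPn mk] := boolP [exists g, k < m g]; last first.
  apply: IHd => //; rewrite big1 // => g _; apply/eqP.
  by rewrite subn_eq0 leqNgt mk.
have [h hk] : exists h, m h < k.
  apply/existsP; apply: contraT => /existsPn mk.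
  suff : \sum_(g : A) k < \sum_g m g by rewrite sum_m sum_nat_const ltnn.
  rewrite (bigD1 g) // [ltnRHS](bigD1 g) //= -addSn leq_add //.
  by apply: leq_sum => x _; rewrite leqNgt mk.
have gh : g != h by apply/eqP => e; move: gk; rewrite e; lia.
have hg : h != g by rewrite eq_sym.
apply: leq_trans (card_words_move gh _) (IHd _ _ _); first by lia.
  move: led; rewrite (bigD1 g) // [in X in _ -> X](bigD1 g) //=.
  rewrite (bigD1 h) //= [in X in _ -> X](bigD1 h) //=.
  rewrite /move_letter eqxx (negPf hg) eqxx.
  under [in X in _ -> X]eq_bigr => x /andP[/negPf -> /negPf ->] do [].
  by set S := \sum_(i | _) _; lia.
rewrite -sum_m (bigD1 g) // [RHS](bigD1 g) //=.
rewrite (bigD1 h) //= [in RHS](bigD1 h) //=.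
rewrite /move_letter eqxx (negPf hg) eqxx.
under eq_bigr => x /andP[/negPf -> /negPf ->] do [].
by lia.
Qed.

(** There are at most [n.+1 ^ #|A|] letter-count profiles, each shared by at most as many words as
    the balanced one. *)
Lemma card_ffun_le_words k : n = #|A| * k ->
  #|A| ^ n <= n.+1 ^ #|A| * #|words (fun=> k)|.
Proof.
move=> nE; pose ty s : {ffun A -> 'I_n.+1} := [ffun g => inord (letter_count s g)].
have tyE s g : ty s g = letter_count s g :> nat.
  rewrite ffunE inordK // ltnS; apply: leq_trans (eq_leq (sum_letter_count s)).
  by rewrite (bigD1 g) //= leq_addr.
have -> : #|A| ^ n = \sum_(s : {ffun 'I_n -> A}) 1.
  by rewrite sum1_card card_ffun card_ord.
rewrite (partition_big ty xpredT) //=.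
rewrite -[X in X ^ _]card_ord -card_ffun -sum_nat_const leq_sum // => t _.
rewrite sum1dep_card.
have [->|[s0]] := set_0Vmem [set s | ty s == t]; first by rewrite cards0.
rewrite inE => /eqP ts0.
apply: leq_trans (card_words_le_balanced (m := fun g => t g) _); last first.
  by rewrite -nE -[RHS](sum_letter_count s0) -ts0; apply: eq_bigr => g _.
apply/subset_leq_card/subsetP => s; rewrite inE => /eqP <-.
by apply/wordsP => g; rewrite tyE.
Qed.

End Words.

(** * Exponential estimates, and permutations between sets of equal size *)

Lemma expn2_le_bin n m : m.*2 <= n -> 2 ^ m <= 'C(n, m).
Proof.
elim: m n => [|m IHm] [|n] // mn.
rewrite -(leq_pmul2l (ltn0Sn m)) -mul_bin_diag.
have /IHm le : m.*2 <= n by lia.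
by apply: leq_trans (leq_mul (_ : m.+1.*2 <= _) le) => //; rewrite expnS; lia.
Qed.

Lemma linear_le_exp2 b n : b.*2 < n -> b * n.+1 <= 2 ^ n.
Proof.
elim: n => // n IHn; rewrite ltnS leq_eqVlt => /orP[/eqP <-|/IHn le].
  have := ltn_expl b (ltnSn 1); rewrite expnS -addnn expnD; nia.
by rewrite expnS; lia.
Qed.

Lemma polynomial_le_exp2 c d :
  exists N, forall k, N <= k -> (c * k).+1 ^ d.+1 <= 2 ^ k.
Proof.
(* With [j] the quotient of [k] by [d.+1], this [b] gives [c * k < b * j.+1]; the threshold gives
   [b.*2 < j], so [linear_le_exp2] bounds the base by [2 ^ j]. *)
pose b := (c * d.+1).+1; exists (b.*2.+1 * d.+1) => k.
rewrite -leq_divRL // => /linear_le_exp2; set j := k %/ _ => le.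
have kE : k < j.+1 * d.+1 by rewrite ltn_ceil.
apply: leq_trans (_ : 2 ^ (j * d.+1) <= _); last by rewrite leq_exp2l // leq_divM.
rewrite expnM leq_exp2r //; apply: leq_trans le.
have : c * k <= c * (j.+1 * d.+1) by rewrite leq_mul2l ltnW ?orbT.
by rewrite /b; nia.
Qed.

(** List [B] before its complement and [D] before its complement, and match equal positions. *)
Lemma perm_imset_ex (T : finType) (B D : {set T}) :
  #|B| = #|D| -> exists s : {perm T}, s @: B = D.
Proof.
move=> BD; pose e (X : {set T}) := enum X ++ enum (~: X).
have eu X : uniq (e X).
  rewrite cat_uniq !enum_uniq andbT; apply/hasPn => x.
  by rewrite !mem_enum inE.
have em X x : x \in e X by rewrite mem_cat !mem_enum inE orbN.
have es X : size (e X) = #|T| by rewrite size_cat -!cardE cardsC.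
have xP x : x \in T by [].
pose f x := nth x (e D) (index x (e B)).
have fi : injective f.
  move=> x y; rewrite /f (set_nth_default y) ?es -?(es B) ?index_mem //.
  move=> /eqP; rewrite nth_uniq ?es -?(es B) ?index_mem // => /eqP ixy.
  by rewrite -(nth_index x (em B x)) ixy nth_index.
exists (perm fi); apply/eqP; rewrite eqEcard card_imset ?BD ?leqnn ?andbT; last first.
  exact: perm_inj.
apply/subsetP => _ /imsetP[x xB ->]; rewrite permE /f /e.
have ix : index x (enum B) < #|D| by rewrite -BD cardE index_mem mem_enum.
by rewrite index_cat mem_enum xB nth_cat -cardE ix -mem_enum mem_nth // -cardE.
Qed.

Local Open Scope ring_scope.

(** * Eigenvalues of the Hadamard graph and the Hoffman bound *)

Section Fourier.
Variables (C : numClosedFieldType) (A : finComNzRingType) (n : nat) (chi : A -> C).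
Hypothesis chi0 : chi 0 = 1.
Hypothesis chiD : forall x y, chi (x + y) = chi x * chi y.
Hypothesis chi_conj : forall x, (chi x)^* = chi (- x).
Hypothesis chi_gen : forall c, c != 0 -> \sum_g chi (c * g) = 0.

Local Notation word := {ffun 'I_n -> A}.
Implicit Types (a s u v : word) (D : {set word}).

(** By [chi_gen] distinct words [a] give distinct characters, so these are all the characters of the
    group of words. *)
Definition pairing a s : C := \prod_i chi (a i * s i).

Lemma pairingDr a s u : pairing a (s + u) = pairing a s * pairing a u.
Proof.
by rewrite -big_split; apply: eq_bigr => i _; rewrite ffunE mulrDr chiD.
Qed.

Lemma pairing_conj a s : (pairing a s)^* = pairing a (- s).
Proof. by rewrite rmorph_prod; apply: eq_bigr => i _; rewrite /= chi_conj ffunE mulrN. Qed.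

Lemma chi_norm x : `|chi x| = 1.
Proof.
apply/eqP; rewrite -(@pexpr_eq1 _ _ 2) ?normr_ge0 //.
by rewrite normCK chi_conj -chiD subrr chi0.
Qed.

Lemma pairing_norm a s : `|pairing a s| = 1.
Proof. by rewrite normr_prod big1 // => i _; rewrite chi_norm. Qed.

Lemma pairing0l s : pairing 0 s = 1.
Proof. by rewrite /pairing big1 // => i _; rewrite ffunE mul0r. Qed.

Lemma pairing0r a : pairing a 0 = 1.
Proof. by rewrite /pairing big1 // => i _; rewrite ffunE mulr0. Qed.

Lemma sum_pairing s : \sum_a pairing a s = (#|A| ^ n)%:R * (s == 0)%:R.
Proof.
have [->|s0] := eqVneq s 0; rewrite (mulr1, mulr0).
  under eq_bigr do rewrite pairing0r.
  by rewrite sumr_const card_ffun card_ord.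
have [i si] : exists i, s i != 0.
  apply/existsP; apply: contraNT s0 => /existsPn s0.
  by apply/eqP/ffunP => i; rewrite ffunE; apply/eqP/negPn/s0.
rewrite -(bigA_distr_bigA (fun i g => chi (g * s i))) (bigD1 i) //=.
by under eq_bigr do rewrite mulrC; rewrite chi_gen ?mul0r.
Qed.

Definition fourier (f : word -> C) a := \sum_u pairing a u * f u.

(** The characters diagonalize the Cayley graph with connection set [D]: after expanding the square,
    summing over [a] leaves only the terms [v = s + u]. The case [D = {0}] is Parseval. *)
Lemma fourier_energy D (f : word -> C) :
  \sum_a (\sum_(s in D) pairing a s) * `|fourier f a| ^+ 2 =
  (#|A| ^ n)%:R * \sum_(s in D) \sum_u f u * (f (s + u))^*.
Proof.
transitivity (\sum_a \sum_(s in D) \sum_(u : word) \sum_(v : word)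
    pairing a (s + u - v) * (f u * (f v)^*)).
  apply: eq_bigr => a _; rewrite mulr_suml; apply: eq_bigr => s _.
  rewrite normCK mulrA mulr_sumr mulr_suml; apply: eq_bigr => u _.
  rewrite rmorph_sum mulr_sumr; apply: eq_bigr => v _.
  by rewrite !pairingDr -pairing_conj rmorphM; ring.
rewrite exchange_big mulr_sumr; apply: eq_bigr => s _.
rewrite exchange_big mulr_sumr; apply: eq_bigr => u _.
rewrite exchange_big (bigD1 (s + u)) //= [X in _ + X]big1 => [|v vsu].
  by rewrite -mulr_suml sum_pairing subrr eqxx mulr1 addr0.
by rewrite -mulr_suml sum_pairing subr_eq0 eq_sym (negPf vsu) mulr0 mul0r.
Qed.

Lemma fourier_parseval (f : word -> C) :
  \sum_a `|fourier f a| ^+ 2 = (#|A| ^ n)%:R * \sum_u `|f u| ^+ 2.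
Proof.
have := fourier_energy [set (0 : word)] f; rewrite big_set1.
under eq_bigr do rewrite big_set1 pairing0r mul1r.
move=> ->; congr (_ * _); apply: eq_bigr => u _.
by rewrite add0r normCK.
Qed.

Variable k : nat.
Hypothesis nE : n = (#|A| * k)%N.

Definition balanced : {set word} := words n (fun _ : A => k).

(** This is [K a], the eigenvalue of the Hadamard graph at the character [a]. *)
Definition ksum a := \sum_(s in balanced) pairing a s.

Lemma ksum_norm a : `|ksum a| <= #|balanced|%:R.
Proof.
apply: le_trans (ler_norm_sum _ _ _) _.
by under eq_bigr do rewrite pairing_norm; rewrite sumr_const.
Qed.

Lemma ksum_perm a (p : {perm 'I_n}) : ksum [ffun i => a (p i)] = ksum a.
Proof.
pose F s : word := [ffun i => s (p i)].
have Fi : injective F.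
  move=> s u /ffunP su; apply/ffunP => i.
  by have := su (p^-1 i)%g; rewrite !ffunE permKV.
rewrite /ksum (reindex_inj Fi) /=; apply: eq_big => [s|s _]; last first.
  rewrite /pairing [RHS](reindex_inj (@perm_inj _ p)).
  by apply: eq_bigr => i _; rewrite !ffunE.
rewrite !inE; apply: eq_forallb => g; congr (_ == _).
rewrite -[RHS](card_preimset _ (@perm_inj _ p)); apply: eq_card => i.
by rewrite !inE ffunE.
Qed.

Lemma sum_chi_balanced c s : s \in balanced -> c != 0 -> \sum_j chi (c * s j) = 0.
Proof.
move=> /wordsP sk c0; rewrite (partition_big s xpredT) //=.
transitivity (\sum_g chi (c * g) *+ k); last by rewrite sumrMnl chi_gen ?mul0rn.
apply: eq_bigr => g _; rewrite -(sk g) -sumr_const big_mkcond [RHS]big_mkcond.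
by apply: eq_bigr => j _; rewrite inE; case: eqP => [->|].
Qed.

(** Adding [c] at [j] multiplies the term of [s] by [chi (c * s j)]; over [j] these factors sum to
    0, as every letter occurs equally often in [s]. *)
Lemma sum_ksum_add a c : c != 0 ->
  \sum_j ksum [ffun i => a i + (if i == j then c else 0)] = 0.
Proof.
move=> c0; rewrite exchange_big big1 // => s sb /=.
transitivity (\sum_j pairing a s * chi (c * s j)).
  apply: eq_bigr => j _; rewrite /pairing (bigD1 j) // [in RHS](bigD1 j) //=.
  rewrite ffunE eqxx mulrDl chiD mulrAC; congr (_ * _ * _).
  by apply: eq_bigr => i /negPf ij; rewrite ffunE ij addr0.
by rewrite -mulr_sumr sum_chi_balanced ?mulr0.
Qed.

Definition support a := [set i | a i != 0].

(* Clearing a coordinate [i0] and adding its value [c] to coordinate [j] permutes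
   [a] when [a j = 0]; the relation [sum_ksum_add] then expresses [ksum a] through
   words of smaller support. *)
Lemma ksum_recursion a i0 : a i0 != 0 ->
  exists b : 'I_n -> word,
    (n - #|support a|).+1%:R * `|ksum a| <= \sum_(j in support a :\ i0) `|ksum (b j)| /\
    {in support a :\ i0, forall j,
      #|support (b j)| = #|support a|.-1 \/ #|support (b j)| = #|support a|.-2}.
Proof.
move=> ai0; set c := a i0 in ai0; pose a' : word := [ffun i => if i == i0 then 0 else a i].
pose b j : word := [ffun i => a' i + (if i == j then c else 0)].
have i0a : i0 \in support a by rewrite inE.
exists b; split.
  have : \sum_j ksum (b j) = 0 by exact: sum_ksum_add.
  rewrite (bigID (mem (support a :\ i0))) /= => /eqP; rewrite addr_eq0 => /eqP bE.
  apply: le_trans (ler_norm_sum _ _ _); rewrite bE normrN.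
  (* For these [j], either [j = i0] or [a j = 0], so [b j] is [a] with coordinates [i0] and [j]
     exchanged. *)
  rewrite (eq_bigr (fun=> ksum a)) => [|j]; last first.
    rewrite !inE negb_and !negbK => ja.
    rewrite -(ksum_perm a (tperm i0 j)); congr ksum; apply/ffunP => i; rewrite !ffunE.
    case: tpermP => [->|->|/eqP/negPf -> /eqP/negPf ->].
    - rewrite eqxx add0r; case: eqP => [<- //|/eqP/negPf i0j].
      by move: ja; rewrite eq_sym i0j => /eqP.
    - rewrite eqxx; have [ji|ji] := eqVneq j i0; rewrite ?add0r //.
      by move: ja; rewrite (negPf ji) => /eqP ->; rewrite add0r.
    - by rewrite addr0.
  rewrite sumr_const normrMn -[leRHS]mulr_natl ler_wpM2r // ler_nat.
  have := cardC (mem (support a :\ i0)); rewrite card_ord.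
  rewrite (cardsD1 i0 (support a)) i0a; set m := #|_ :\ _|.
  rewrite (_ : #|[predC _]| = #|[pred j | j \notin support a :\ i0]|).
    have : (0 < #|[pred j | j \notin support a :\ i0]|)%N.
      by apply/card_gt0P; exists i0; rewrite !inE eqxx.
    by move: #|[pred _ | _]| m => p m'; clear; lia.
  by apply: eq_card.
move=> j; rewrite !inE => /andP[ji0 aj].
have jS : j \in support a :\ i0 by rewrite !inE ji0.
have sE : #|support a|.-1 = #|support a :\ i0| by rewrite [in LHS](cardsD1 i0) i0a.
have [ac|ac] := eqVneq (a j + c) 0; [right|left].
  transitivity #|support a :\ i0 :\ j|; last first.
    by rewrite [in RHS](cardsD1 i0) i0a (cardsD1 j (_ :\ i0)) jS.
  apply: eq_card => i; rewrite !inE !ffunE.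
  case: (eqVneq i j) => [->|ij]; first by rewrite (negPf ji0) ac eqxx.
  by case: (i == i0); rewrite addr0 ?eqxx.
rewrite sE; apply: eq_card => i; rewrite !inE !ffunE.
case: (eqVneq i j) => [->|ij]; first by rewrite (negPf ji0) ac aj.
by case: (i == i0); rewrite addr0 ?eqxx.
Qed.

(** Induction on the support size [t] through [ksum_recursion]; the second hypothesis says that its
    [t - 1] terms do not outnumber its factor [n - t + 1]. *)
Lemma ksum_small a : (0 < #|support a|)%N -> (#|support a|.*2 <= n.+2)%N ->
  n.-1%:R * `|ksum a| <= #|balanced|%:R.
Proof.
move: {2}#|support a| (leqnn #|support a|) => t; elim: t a => [|t IHt] a lt t0 tn.
  by move: lt t0; case: #|_|.
have [i0 i0s] := card_gt0P t0.
have /ksum_recursion[b [le bs]] : a i0 != 0 by move: i0s; rewrite inE.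
have tlt : (#|support a| <= n)%N by rewrite -[leqRHS]card_ord max_card.
have sE : #|support a :\ i0| = #|support a|.-1 by rewrite [in RHS](cardsD1 i0) i0s.
have [t1|t1] := leqP #|support a| 1.
  have E1 : #|support a :\ i0| = 0%N by lia.
  move: le; rewrite (eq_bigl pred0); last by apply/card0_eq.
  rewrite big_pred0_eq pmulr_rle0 ?ltr0n // normr_le0 => /eqP ->.
  by rewrite normr0 mulr0 ler0n.
(* Here [b j] may be 0, where [ksum] is maximal, so only the trivial bound applies; but the factor
   is already [n.-1] and one term remains. *)
have [t2|t2] := leqP #|support a| 2.
  have e : (n - #|support a|).+1 = n.-1 by lia.
  apply: le_trans (_ : \sum_(j in support a :\ i0) #|balanced|%:R <= _).
    by rewrite -e; apply: le_trans le _; apply: ler_sum => j _; exact: ksum_norm.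
  by rewrite sumr_const sE (_ : _.-1 = 1%N) //; lia.
rewrite -(@ler_pM2l _ (n - #|support a|).+1%:R) ?ltr0n // mulrCA.
apply: le_trans (_ : \sum_(j in support a :\ i0) #|balanced|%:R <= _).
  apply: le_trans (ler_wpM2l (ler0n _ _) le) _; rewrite mulr_sumr.
  by apply: ler_sum => j /bs bj; apply: IHt; lia.
rewrite sumr_const sE -[leLHS]mulr_natl ler_wpM2r ?ler0n // ler_nat; lia.
Qed.

(** Each set of size [#|support a|] is the support of a rearrangement of [a], with the same [ksum];
    Parseval for the indicator of [balanced] evaluates the sum of all squares. *)
Lemma ksum_large a :
  'C(n, n - #|support a|)%:R * `|ksum a| ^+ 2 <= (#|A| ^ n)%:R * #|balanced|%:R.
Proof.
have -> : (#|A| ^ n)%:R * #|balanced|%:R = \sum_b `|ksum b| ^+ 2.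
  rewrite (eq_bigr (fun b => `|fourier (fun u => (u \in balanced)%:R) b| ^+ 2)).
    rewrite fourier_parseval; congr (_ * _); rewrite -sum1_card natr_sum big_mkcond.
    by apply: eq_bigr => u _; case: (u \in _); rewrite ?normr1 ?normr0 ?expr1n ?expr0n.
  move=> b _; congr (`| _ | ^+ 2); rewrite /ksum big_mkcond; apply: eq_bigr => u _.
  by case: (u \in _); rewrite ?mulr1 ?mulr0.
have sle : (#|support a| <= n)%N by rewrite -[leqRHS]card_ord max_card.
rewrite bin_sub // -[n in 'C(n, _)]card_ord -card_draws mulr_natl -sumr_const.
rewrite [leRHS](partition_big support xpredT) //= [leLHS]big_mkcond ler_sum // => B _.
have sq_ge0 b : 0 <= `|ksum b| ^+ 2 by rewrite exprn_ge0.
rewrite inE; case: eqP => [cB|_]; last by apply: sumr_ge0.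
have [p pB] := perm_imset_ex cB.
rewrite (bigD1 [ffun i => a (p i)]) /=.
  by rewrite ksum_perm lerDl; apply: sumr_ge0.
apply/eqP/setP => i; rewrite inE ffunE -(mem_imset B _ (@perm_inj _ p)).
by rewrite pB inE.
Qed.

Hypothesis balanced_sum : forall c s, s \in balanced -> \prod_i chi (c * s i) = 1.

(** By [balanced_sum], constant words pair to 1 with balanced words; for ['Z_q] the parity
    assumption supplies this. *)
Lemma ksum_shift a c : ksum [ffun i => a i - c] = ksum a.
Proof.
apply: eq_bigr => s sb.
transitivity (pairing a s * \prod_i chi (- c * s i)); last by rewrite balanced_sum ?mulr1.
by rewrite -big_split; apply: eq_bigr => i _; rewrite ffunE mulrDl chiD.
Qed.

Hypothesis k_large : ((#|A| * k).+1 ^ (#|A|.+2) <= 2 ^ k)%N.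

Lemma ksum_dichotomy a :
  ksum a = #|balanced|%:R \/ n.-1%:R * `|ksum a| <= #|balanced|%:R.
Proof.
have A0 : (0 < #|A|)%N by apply/card_gt0P; exists 0.
(* Pigeonhole: some letter occurs at least [k] times, and subtracting it leaves at least [k]
   zeros. *)
have [c ck] : exists c, (k <= letter_count a c)%N.
  apply/existsP; apply: contraT => /existsPn ck.
  suff : (\sum_c letter_count a c < \sum_(c : A) k)%N.
    by rewrite sum_letter_count sum_nat_const -nE ltnn.
  rewrite (bigD1 0) // [ltnRHS](bigD1 0) //= -addSn leq_add //.
    by rewrite ltnNge ck.
  by apply: leq_sum => x _; rewrite ltnW // ltnNge ck.
rewrite -(ksum_shift a c); set b := [ffun i => _].
have bE : (letter_count a c + #|support b| = n)%N.
  rewrite -[RHS]card_ord -(cardC [set i | a i == c]); congr (_ + _)%N.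
  by apply: eq_card => i; rewrite !inE ffunE subr_eq0.
have [b0|b0] := posnP #|support b|.
  left; rewrite /ksum (eq_bigr (fun=> 1)) ?sumr_const // => s _.
  rewrite -(pairing0l s); congr pairing; apply/ffunP => i; rewrite [RHS]ffunE.
  by apply/eqP/negPn; have /negbT := card0_eq b0 i; rewrite inE.
right; have [small|large] := leqP #|support b|.*2 n.+2; first exact: ksum_small.
have le1 := ksum_large b.
have le2 : (n.+1 ^ #|A|.+2 <= 'C(n, n - #|support b|))%N.
  rewrite {1}nE; apply: leq_trans k_large _.
  apply: leq_trans (expn2_le_bin (_ : (n - #|support b|).*2 <= _)%N); last by lia.
  rewrite leq_exp2l //; move: bE ck; clear.
  by move: (letter_count a c) #|support b| => x y; lia.
have le3 := card_ffun_le_words nE; rewrite -/balanced in le3.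
(* With [S = balanced], the three bounds chain to [n.+1 ^ (#|A| + 2) * |ksum b|^2 <= n.+1 ^ #|A| *
   |S|^2]; cancel and take square roots. *)
have le4 : n.+1%:R * `|ksum b| <= #|balanced|%:R.
  rewrite -(@ler_pXn2r _ 2) ?nnegrE ?mulr_ge0 //.
  have n0 : 0 < (n.+1 ^ #|A|)%:R :> C by rewrite ltr0n expn_gt0.
  rewrite -(ler_pM2l n0) exprMn -natrX mulrA -natrM -expnD addn2.
  apply: le_trans (le_trans _ le1) _; first by rewrite ler_wpM2r ?exprn_ge0 // ler_nat.
   rewrite expr2 mulrA ler_wpM2r ?ler0n //.
  by rewrite -natrM ler_nat.
by apply: le_trans le4; rewrite ler_wpM2r // ler_nat; lia.
Qed.

(* The energy of [f] over the edges is the average of the eigenvalues [ksum a] weighted by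
   the spectral masses [W a].  Nonzero [a] may share the top eigenvalue [#|balanced|]
   (the graph need not be connected); their mass only helps. *)
Lemma hoffman_bound (I : finType) (f : word -> I -> C) (N : C) :
  (0 < n)%N -> (0 < #|balanced|)%N ->
  (forall u s, s \in balanced -> \sum_x f u x * (f (s + u) x)^* = 0) ->
  (forall u, \sum_x `|f u x| ^+ 2 = N) -> 
  (\sum_x `|\sum_u f u x| ^+ 2) * n%:R <= ((#|A| ^ n) ^ 2)%:R * N.
Proof.
move=> n0 S0 forth fN.
pose W a := \sum_x `|fourier (f^~ x) a| ^+ 2.
have W_ge0 a : 0 <= W a by apply: sumr_ge0 => x _; rewrite exprn_ge0.
have WT : \sum_a W a = ((#|A| ^ n) ^ 2)%:R * N.
  rewrite exchange_big /=; under eq_bigr do rewrite fourier_parseval.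
  rewrite -mulr_sumr exchange_big /=; under eq_bigr do rewrite fN.
  by rewrite sumr_const card_ffun card_ord -[X in _ * X]mulr_natl mulrA -natrM.
have WK : \sum_a ksum a * W a = 0.
  under eq_bigr do rewrite mulr_sumr.
  rewrite exchange_big /=; under eq_bigr do rewrite fourier_energy.
  rewrite -mulr_sumr exchange_big big1 ?mulr0 // => s sb /=.
  by rewrite exchange_big big1 // => u _; rewrite forth.
have W0 : \sum_x `|\sum_u f u x| ^+ 2 = W 0.
  apply: eq_bigr => x _; congr (`| _ | ^+ 2).
  by apply: eq_bigr => u _; rewrite pairing0l mul1r.
rewrite W0 -WT; set B : C := #|balanced|%:R.
have B0 : 0 < B by rewrite ltr0n.
pose Q := [pred a | ksum a == B].
have Q0 : Q 0.
  by rewrite inE /ksum; under eq_bigr do rewrite pairing0l; rewrite sumr_const.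
rewrite (bigID Q) /= in WK.
rewrite [leRHS](bigID Q) /=.
have W0Q : W 0 <= \sum_(a | Q a) W a.
  by rewrite (bigD1 (0 : word)) //= lerDl; apply: sumr_ge0.
(* By [WK] the mass on [Q], weighted by [B], is cancelled by the rest, where
   [(n - 1) * |ksum a| <= B]; so the rest has at least [n - 1] times the mass on [Q]. *)
have QN : n.-1%:R * \sum_(a | Q a) W a <= \sum_(a | ~~ Q a) W a.
  rewrite -(ler_pM2l B0).
  have QW a : ksum a == B -> ksum a * W a = B * W a by move/eqP ->.
  rewrite (eq_bigr _ QW) in WK.
  move/eqP: WK; rewrite -mulr_sumr addr_eq0 => /eqP WK.
  rewrite mulrCA WK -[X in X <= _]ger0_norm; last first.
    rewrite -WK mulr_ge0 ?ler0n //; apply: mulr_ge0; first exact: ltW.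
    exact: sumr_ge0.
  rewrite normrM normrN normr_nat mulr_sumr.
  apply: le_trans (ler_wpM2l (ler0n _ _) (ler_norm_sum _ _ _)) _.
  rewrite mulr_sumr; apply: ler_sum => a aQ.
  rewrite normrM (ger0_norm (W_ge0 a)) mulrA ler_wpM2r //.
  by case: (ksum_dichotomy a) => // /eqP; rewrite (negPf aQ).
rewrite -[n in n%:R](prednK n0) -natr1 mulrDr mulr1 mulrC addrC lerD //.
by apply: le_trans QN; rewrite ler_wpM2l ?ler0n.
Qed.

End Fourier.

(** * Quantum colorings *)

Lemma norm_sum_sqr_le (C : numClosedFieldType) (I : finType) (z : I -> C) :
  `|\sum_a z a| ^+ 2 <= #|I|%:R * \sum_a `|z a| ^+ 2.
Proof.
apply: (@le_trans _ _ ((\sum_a `|z a|) ^+ 2)).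
  by rewrite ler_pXn2r ?nnegrE ?ler_norm_sum ?sumr_ge0.
have -> : #|I|%:R * (\sum_a `|z a| ^+ 2) =
    \sum_a \sum_b (`|z a| ^+ 2 + `|z b| ^+ 2) / 2.
  under [RHS]eq_bigr => a _ do rewrite -mulr_suml big_split /= sumr_const.
  rewrite -mulr_suml big_split /= sumr_const sumrMnl.
  by rewrite -[in RHS]mulr2n -[X in X / 2]mulr_natr mulfK ?pnatr_eq0 // mulr_natl.
rewrite expr2 mulr_suml; apply: ler_sum => a _; rewrite mulr_sumr.
by apply: ler_sum => b _; apply: real_leif_mean_square; rewrite normr_real.
Qed.

Section LowerBound.
Variables (R : realType) (V : finType) (eG : rel V).
Variables (s k : nat) (P : V -> 'I_s -> 'M[R[i]]_k).
Hypothesis qP : is_quantum_homomorphism eG (@complete_graph s) P.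

(** All entries of the [s] matrices at [v] in one vector: by Hermitian symmetry, inner products of
    such vectors are sums of traces. *)
Definition qentry v (x : 'I_s * ('I_k * 'I_k)) : R[i] := P v x.1 x.2.1 x.2.2.

Lemma qentry_dot u v :
  \sum_x qentry u x * (qentry v x)^* = \sum_a \tr (P u a *m P v a).
Proof.
rewrite -(pair_big xpredT xpredT (fun a ij => qentry u (a, ij) * (qentry v (a, ij))^*)) /=.
apply: eq_bigr => a _.
rewrite -(pair_big xpredT xpredT
  (fun i j => qentry u (a, (i, j)) * (qentry v (a, (i, j)))^*)) /=.
apply: eq_bigr => i _; rewrite mxE; apply: eq_bigr => j _; rewrite /qentry /=.
have /is_hermitianmxP := qhom_hermitian qP v a.
by rewrite expr0 scale1r => /matrixP/(_ j i); rewrite !mxE => ->.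
Qed.

Lemma qentry_orth u v : eG u v -> \sum_x qentry u x * (qentry v x)^* = 0.
Proof.
move=> uv; rewrite qentry_dot big1 // => a _.
by rewrite (qhom_edge qP) ?mxtrace0 // /complete_graph eqxx.
Qed.

Lemma qentry_norm v : \sum_x `|qentry v x| ^+ 2 = k%:R.
Proof.
under eq_bigr do rewrite normCK; rewrite qentry_dot.
under eq_bigr do rewrite (qhom_orth qP) eqxx scale1r.
by rewrite -raddf_sum /= (qhom_sum qP) mxtrace1.
Qed.

(** Keep only the diagonal positions [(i, i)]: there the entries summed over colors and over [t]
    give [#|T|], and Cauchy-Schwarz over the colors costs the factor [s]. *)
Lemma qentry_sum (T : finType) (u : T -> V) :
  (#|T| ^ 2 * k)%:R <= s%:R * \sum_x `|\sum_t qentry (u t) x| ^+ 2.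
Proof.
rewrite -(pair_big xpredT xpredT (fun a ij => `|\sum_t qentry (u t) (a, ij)| ^+ 2)) /=.
rewrite exchange_big /=.
rewrite -(pair_big xpredT xpredT
  (fun i j => \sum_a `|\sum_t qentry (u t) (a, (i, j))| ^+ 2)) /=.
rewrite mulr_sumr natrM mulrC mulr_natl -[X in _ *+ X]card_ord -sumr_const.
apply: ler_sum => i _; rewrite mulr_sumr (bigD1 i) //= ler_wpDr //.
  by apply: sumr_ge0 => j _; rewrite mulr_ge0 ?ler0n ?sumr_ge0 // => a _; rewrite exprn_ge0.
rewrite -{1}[s]card_ord; apply: le_trans (norm_sum_sqr_le _).
rewrite exchange_big (eq_bigr (fun=> 1)) ?sumr_const /=.
  by rewrite normr_nat natrX.
by move=> t _; have /matrixP/(_ i i) := qhom_sum qP (u t); rewrite summxE mxE eqxx.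
Qed.

End LowerBound.

(** By orthogonality the vectors of the clique have a sum of squared norm [#|T| * k], to be compared
    with [qentry_sum]. *)
Lemma clique_bound (R : realType) (V : finType) (eG : rel V) (T : finType)
    (u : T -> V) (s : nat) :
  (forall t t', t != t' -> eG (u t) (u t')) ->
  quantum_homomorphic R eG (@complete_graph s) -> (#|T| <= s)%N.
Proof.
move=> uE [k [P [k0 qP]]].
have [T0|T0] := posnP #|T|; first by rewrite T0.
have := qentry_sum qP u.
have -> : \sum_x `|\sum_t qentry P (u t) x| ^+ 2 = (#|T| * k)%:R.
  under eq_bigr do rewrite normCK rmorph_sum mulr_suml.
  rewrite exchange_big (eq_bigr (fun=> k%:R)) /=; first by rewrite sumr_const natrM mulr_natl.
  move=> t _; under eq_bigr do rewrite mulr_sumr.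
  rewrite exchange_big (bigD1 t) //= [X in _ + X]big1 => [|t' tt'].
    by rewrite addr0 -(qentry_norm qP (u t)); under [RHS]eq_bigr do rewrite normCK.
  by rewrite (qentry_orth qP) // uE // eq_sym.
by rewrite -natrM ler_nat -mulnn -mulnA leq_pmul2r // muln_gt0 T0.
Qed.

Lemma prim_root_ex (C : numClosedFieldType) n :
  (0 < n)%N -> exists w : C, n.-primitive_root w.
Proof.
move=> n0; have [r] := closed_field_poly_normal ('X^n - 1 : {poly C}).
rewrite lead_coefXnsubC // scale1r => rE.
suff /hasP[w _ wn] : has n.-primitive_root r by exists w.
apply: has_prim_root => //.
- by apply/allP => z; rewrite -root_prod_XsubC -rE.
- by rewrite -separable_prod_XsubC -rE separable_Xn_sub_1 // pnatr_eq0 -lt0n.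
- by rewrite -ltnS -(size_prod_XsubC r id) -rE size_XnsubC.
Qed.

Lemma prim_root_conj (C : numClosedFieldType) n (w : C) :
  (0 < n)%N -> w ^+ n = 1 -> w^* = w^-1.
Proof.
move=> n0 wn; have w1 : `|w| = 1.
  by apply/eqP; rewrite -(@pexpr_eq1 _ _ n) // -normrX wn normr1.
by rewrite [RHS]invC_norm w1 expr1n invr1 mul1r.
Qed.

(** * Quantum coloring from a nontrivial character *)

Section UpperBound.
Variables (R : realType) (G : finZmodType) (chi : G -> R[i]).
Hypothesis chi0 : chi 0 = 1.
Hypothesis chiD : forall x y, chi (x + y) = chi x * chi y.
Hypothesis chi_conj : forall x, (chi x)^* = chi (- x).
Hypothesis chi_sum : \sum_g chi g = 0.

Lemma quantum_coloring n : (0 < n)%N -> (#|G| %| n)%N ->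
  quantum_homomorphic R (@hadamard_graph G n) (@complete_graph n).
Proof.
move=> n0 Gn; have [w wn] := prim_root_ex R[i] n0.
have w_conj : w^* = w^-1 by apply: prim_root_conj n0 (prim_expr_order wn).
have w0 : w != 0 by rewrite (prim_root_eq0 wn) -lt0n.
have nz : n%:R != 0 :> R[i] by rewrite pnatr_eq0 -lt0n.
(* For fixed [x] these are [n] orthogonal vectors of squared norm [n]; [P x a] below projects onto
   the line of [v x a]. *)
pose v (x : {ffun 'I_n -> G}) (a i : 'I_n) : R[i] := chi (x i) * w ^+ (a * i).
have v_conj x a i : (v x a i)^* = chi (- x i) * w ^- (a * i).
  by rewrite rmorphM rmorphXn /= chi_conj w_conj exprVn.
pose P x a : 'M[R[i]]_n := \matrix_(i, j) (n%:R^-1 * (v x a i * (v x a j)^*)).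
have mulP x y a b : P x a *m P y b =
    \matrix_(i, j) (n%:R^-1 * (v x a i * (v y b j)^*) *
      (n%:R^-1 * \sum_l (v x a l)^* * v y b l)).
  apply/matrixP => i j; rewrite !mxE mulr_sumr mulr_sumr; apply: eq_bigr => l _.
  by rewrite !mxE; ring.
have geom (i j : 'I_n) : \sum_(l < n) (w ^+ i / w ^+ j) ^+ l = n%:R * (i == j)%:R.
  have [->|ij] := eqVneq i j.
    rewrite mulfV ?expf_neq0 // mulr1.
    by under eq_bigr do rewrite expr1n; rewrite sumr_const card_ord.
  set z := w ^+ i / _; have z1 : z - 1 != 0.
    rewrite subr_eq0; apply: contra ij => /eqP e; apply/eqP/val_inj => /=.
    have : w ^+ i == w ^+ j by move/divr1_eq: e => ->.
    by rewrite (eq_prim_root_expr wn) !modn_small // => /eqP.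
  rewrite mulr0; apply: (mulfI z1); rewrite mulr0 -subrX1 exprMn exprVn.
  rewrite -!exprM ![(_ * n)%N]mulnC !exprM (prim_expr_order wn).
  by rewrite !expr1n invr1 mulr1 subrr.
have swap_conj (y z : R[i]) : (n%:R^-1 * (y * z^*))^* = n%:R^-1 * (z * y^*).
  by rewrite !rmorphM /= conjCK fmorphV rmorph_nat [z * _]mulrC.
exists n, P; split=> //; split.
- move=> x a; apply/is_hermitianmxP; rewrite expr0 scale1r; apply/matrixP => i j.
  by rewrite !mxE swap_conj.
- move=> x; apply/matrixP => i j; rewrite summxE mxE.
  under eq_bigr do rewrite mxE v_conj.
  rewrite -mulr_sumr.
  under eq_bigr => a _ do
    rewrite /v mulrACA -chiD [(a * i)%N]mulnC [(a * j)%N]mulnC !exprM -exprVn -exprMn.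
  rewrite -mulr_sumr geom; case: eqP => [->|_]; last by rewrite !mulr0.
  by rewrite subrr chi0 mul1r mulr1 mulVf.
- move=> x a b; rewrite mulP.
  have -> : \sum_l (v x a l)^* * v x b l = n%:R * (a == b)%:R.
    under eq_bigr => l _ do
      rewrite v_conj /v mulrACA -chiD addNr chi0 mul1r !exprM -exprVn -exprMn.
    by under eq_bigr do rewrite mulrC; rewrite geom eq_sym.
  apply/matrixP => i j; rewrite !mxE mulKf // mulrC.
  by case: eqP => [->|_]; rewrite ?mul0r.
- move=> x y a b xy /negPn/eqP <-; rewrite mulP.
  suff -> : \sum_l (v x a l)^* * v y a l = 0.
    by apply/matrixP => i j; rewrite !mxE !mulr0.
  (* For equal colors the Fourier factors cancel; grouping [l] by [y l - x l] leaves a multiple of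
     [\sum_g chi g]. *)
  under eq_bigr => l _ do rewrite v_conj /v mulrACA -chiD mulVf ?expf_neq0 // mulr1.
  rewrite (partition_big (fun l => y l - x l) xpredT) //=.
  transitivity (\sum_g chi g *+ (n %/ #|G|)); last by rewrite sumrMnl chi_sum mul0rn.
  apply: eq_bigr => g _; have /forallP/(_ g)/eqP <- := xy.
  rewrite -sumr_const big_mkcond [RHS]big_mkcond.
  by apply: eq_bigr => l _; rewrite inE addrC; case: eqP => [->|].
Qed.

End UpperBound.

(** * Characters, cliques and the quantum chromatic number *)

(** Translation by [h] multiplies the sum by [chi h]. *)
Lemma sum_char0 (C : idomainType) (G : finZmodType) (chi : G -> C) h :
  (forall x y, chi (x + y) = chi x * chi y) -> chi h != 1 -> \sum_g chi g = 0.
Proof.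
move=> chiD h1; apply/eqP; rewrite -(mulIr_eq0 _ (_ : GRing.rreg (1 - chi h))).
  rewrite mulrBr mulr1 subr_eq0 mulr_suml (reindex_inj (addIr h)).
  by apply/eqP/eq_bigr => g _; rewrite chiD.
by apply/rregP; rewrite subr_eq0 eq_sym.
Qed.

Section CyclicCharacter.
Variables (C : numClosedFieldType) (q : nat) (w : C).
Hypotheses (q1 : (1 < q)%N) (wq : q.-primitive_root w).

Definition Zp_char (x : 'Z_q) : C := w ^+ x.

Lemma card_Zq : #|{: 'Z_q}| = q.
Proof. by rewrite card_ord Zp_cast. Qed.

Lemma Zp_char0 : Zp_char 0 = 1.
Proof. by []. Qed.

Lemma Zp_charD x y : Zp_char (x + y) = Zp_char x * Zp_char y.
Proof. by rewrite /Zp_char /= [X in (_ %% X)%N]Zp_cast // (prim_expr_mod wq) exprD. Qed.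

Lemma Zp_charM x y : Zp_char (x * y) = w ^+ (x * y)%N.
Proof. by rewrite /Zp_char /= [X in (_ %% X)%N]Zp_cast // (prim_expr_mod wq). Qed.

Lemma Zp_char_conj x : (Zp_char x)^* = Zp_char (- x).
Proof.
have xq : Zp_char x ^+ q = 1 by rewrite -exprM mulnC exprM (prim_expr_order wq) expr1n.
rewrite (prim_root_conj (ltnW q1) xq); apply: (mulfI (_ : Zp_char x != 0)).
  by rewrite expf_neq0 // (prim_root_eq0 wq) -lt0n ltnW.
by rewrite -Zp_charD subrr mulfV // expf_neq0 // (prim_root_eq0 wq) -lt0n ltnW.
Qed.

Lemma Zp_char_neq1 c : c != 0 -> Zp_char c != 1.
Proof.
move=> c0; rewrite -(prim_order_dvd wq); apply: contra c0 => qc.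
have cq : (c < q)%N by rewrite -[ltnRHS]Zp_cast.
by apply/eqP/val_inj => /=; move: qc; rewrite /dvdn modn_small // => /eqP.
Qed.

Lemma Zp_char_sum c : c != 0 -> \sum_g Zp_char (c * g) = 0.
Proof.
move=> c0; apply: (@sum_char0 _ _ (fun g => Zp_char (c * g)) 1) => [x y|].
  by rewrite mulrDr Zp_charD.
by rewrite mulr1 Zp_char_neq1.
Qed.

(** The representatives of the coordinates add up to ['C(q, 2) * k], which is [q] times half of the
    even number [(q - 1) * k]. *)
Lemma Zp_char_balanced n k (s : {ffun 'I_n -> 'Z_q}) c : ~~ odd ((q - 1) * k) ->
  s \in balanced 'Z_q n k -> \prod_i Zp_char (c * s i) = 1.
Proof.
move=> ev /wordsP sk.
have sum_s : (\sum_i s i = 'C(q, 2) * k)%N.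
  transitivity (\sum_(g : 'Z_q) g * k)%N; last first.
    rewrite -big_distrl /= -(big_mkord xpredT id) [X in \sum_(0 <= _ < X) _]Zp_cast //.
    by rewrite bin2_sum.
  rewrite (partition_big s xpredT) //=; apply: eq_bigr => g _.
  rewrite mulnC -(sk g) -sum_nat_const big_mkcond [RHS]big_mkcond.
  by apply: eq_bigr => i _; rewrite inE; case: eqP => [->|].
under eq_bigr do rewrite Zp_charM exprM.
rewrite -expr_sum sum_s; apply/eqP; rewrite -exprM -(prim_order_dvd wq) dvdn_mull //.
apply/dvdnP; exists ((q - 1) * k)./2; apply/eqP.
rewrite -(eqn_pmul2l (_ : 0 < 2)%N) // mulnA -(mul_bin_diag q 1) bin1 -subn1.
by rewrite -mulnA [(2 * _)%N]mulnA mul2n even_halfK // mulnC.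
Qed.

End CyclicCharacter.

Lemma chromatic_Zq (R : realType) (q : nat) : (2 <= q)%N ->
  exists N : nat, forall n : nat,
     (0 < n)%N -> (q %| n)%N -> ~~ odd (((q - 1) * n) %/ q) -> (N <= n)%N ->
     is_quantum_chromatic_number R (@hadamard_graph 'Z_q n) n.
Proof.
(* For [k = n / q] this provides [(q * k).+1 ^ q.+2 <= 2 ^ k], the condition [k_large]; hence the
   threshold [q * N] for [n]. *)
move=> q1; have [N NE] := polynomial_le_exp2 q q.+1.
exists (q * N)%N => n n0 qn ev Nn; have q0 := ltnW q1.
have [w wq] := prim_root_ex R[i] q0.
have nE : n = (q * (n %/ q))%N by rewrite mulnC divnK.
set k := (n %/ q)%N in nE.
have Nk : (N <= k)%N by rewrite nE leq_pmul2l in Nn.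
split=> [|s [d [P [d0 qP]]]].
  apply: (quantum_coloring (chi := Zp_char w)) => //; last by rewrite card_Zq.
  - exact: Zp_charD.
  - exact: Zp_char_conj.
  - have := Zp_char_sum q1 wq (oner_neq0 _).
    by under eq_bigr do rewrite mul1r.
have nE' : n = (#|'Z_q| * k)%N by rewrite card_Zq.
have k_large : ((#|'Z_q| * k).+1 ^ (#|'Z_q|.+2) <= 2 ^ k)%N by rewrite card_Zq // NE.
have ev' : ~~ odd ((q - 1) * k).
  by move: ev; rewrite {1}nE mulnCA mulKn.
have bal0 : (0 < #|balanced 'Z_q n k|)%N.
  have := card_ffun_le_words nE'; rewrite -/(balanced _ _ _).
  by case: #|balanced _ _ _| => //; rewrite muln0 leqn0 expn_eq0 card_Zq // -[q]prednK.
have adj u v : v \in balanced 'Z_q n k -> hadamard_graph u (v + u).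
  move=> /wordsP vk; apply/forallP => g; rewrite card_Zq // -/k -(vk g).
  by apply/eqP/eq_card => i; rewrite !inE !ffunE addrK.
have orth u v : v \in balanced 'Z_q n k ->
    \sum_x qentry P u x * (qentry P (v + u) x)^* = 0.
  by move=> vb; rewrite (qentry_orth qP) ?adj.
have bal_sum c v : v \in balanced 'Z_q n k -> \prod_i Zp_char w (c * v i) = 1.
  exact: Zp_char_balanced.
have up := hoffman_bound (Zp_char0 q w) (Zp_charD q1 wq) (Zp_char_conj q1 wq)
  (Zp_char_sum q1 wq) nE' bal_sum k_large
  n0 bal0 orth (qentry_norm qP).
(* The sum over all vertices is bounded below here and above by the Hoffman bound [up]. *)
have := qentry_sum qP (fun u : {ffun 'I_n -> 'Z_q} => u).
rewrite card_ffun (card_ord n) natrM => low.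
have X0 : 0 < ((#|'Z_q| ^ n) ^ 2)%:R * d%:R :> R[i].
  by rewrite -natrM ltr0n muln_gt0 d0 !expn_gt0 card_Zq // q0.
rewrite -(ler_nat R[i]) -(ler_pM2l X0).
apply: le_trans (ler_wpM2r (ler0n _ n) low) _; rewrite -mulrA mulrC.
by rewrite ler_wpM2r.
Qed.

(** * Additive surjections and cliques from finite fields *)

Section AdditiveSurjection.
Variables (E F : finZmodType) (phi : E -> F).
Hypotheses (phiB : {morph phi : x y / x - y}) (phi_surj : forall y, exists x, phi x = y).

(** The fibers are translates of the kernel. *)
Lemma card_fiber g : #|[set x | phi x == g]| = (#|E| %/ #|F|)%N.
Proof.
have fib h : #|[set x | phi x == h]| = #|[set x | phi x == 0]|.
  have [z <-] := phi_surj h; rewrite -(card_imset _ (addIr (- z))).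
  apply: eq_card => x; rewrite inE; apply/imsetP/eqP => [[y]|x0].
    by rewrite inE => /eqP yz ->; rewrite phiB yz subrr.
  by exists (x + z); rewrite ?addrK // inE -subr_eq0 -phiB addrK x0.
have : #|E| = (#|F| * #|[set x | phi x == g]|)%N.
  rewrite -[LHS]sum1_card (partition_big phi xpredT) //= -sum_nat_const.
  by apply: eq_bigr => h _; rewrite sum1dep_card !fib.
by move=> ->; rewrite mulKn //; apply/card_gt0P; exists 0.
Qed.

End AdditiveSurjection.

Lemma additive_surjection (p : nat) (E F : finFieldType) :
  p \in [pchar E] -> p \in [pchar F] -> (#|F| <= #|E|)%N ->
  exists2 phi : E -> F, {morph phi : x y / x - y} & forall y, exists x, phi x = y.
Proof.
move=> pE pF FE; have p1 := prime_gt1 (pcharf_prime pE).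
pose E' := pPrimeCharType pE; pose F' := pPrimeCharType pF.
pose m := dim E'; pose e := dim F'.
have em : (e <= m)%N.
  rewrite /e /m -!dimvf !pprimeChar_dimf -(leq_exp2l _ _ p1).
  by rewrite -(card_pprimeChar pE) -(card_pprimeChar pF).
(* In coordinates over the prime field, [phi] keeps the first [e] entries; padding with zeros gives
   preimages. *)
pose phi (x : E') : F' := r2v (v2r x *m pid_mx e).
exists phi => [x y|y].
  by rewrite /phi linearB mulmxBl linearB.
exists (r2v (v2r (y : F') *m pid_mx e) : E').
rewrite /phi r2vK -mulmxA pid_mx_id // pid_mx_1 mulmx1; exact: (v2rK (y : F')).
Qed.

(** Rows [x] and [y] of the table [phi (x * z)] differ by [phi ((y - x) * z)]; here [(y - x) * z]
    runs over [E] with [z], and [phi] has fibers of equal size. *)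
Lemma hadamard_clique (R : realType) (E F : finFieldType) (phi : E -> F) s :
  {morph phi : x y / x - y} -> (forall y, exists x, phi x = y) ->
  quantum_homomorphic R (@hadamard_graph F #|E|) (@complete_graph s) -> (#|E| <= s)%N.
Proof.
move=> phiB phi_surj.
apply: (clique_bound (u := fun x : E => [ffun i => phi (x * enum_val i)])) => x y xy.
apply/forallP => g; rewrite -(card_fiber phiB phi_surj g); apply/eqP.
have yx : y - x != 0 by rewrite subr_eq0 eq_sym.
have bij : injective (fun i : 'I_#|E| => (y - x) * enum_val i).
  by move=> i j /(mulfI yx) /enum_val_inj.
rewrite -(card_imset _ bij); apply: eq_card => z; rewrite inE.
apply/imsetP/eqP => [|zg].
  by case=> i; rewrite inE !ffunE -phiB -mulrBl => /eqP <- ->.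
exists (enum_rank ((y - x)^-1 * z)); last by rewrite enum_rankK mulVKf.
by rewrite inE !ffunE -phiB -mulrBl enum_rankK mulVKf // zg.
Qed.

Lemma chromatic_Fq (R : realType) (n : nat) (F : finFieldType) :
  (0 < n)%N -> (#|F| %| n)%N -> prime_power n -> prime_power #|F| ->
  is_quantum_chromatic_number R (@hadamard_graph F n) n.
Proof.
move=> n0 Fn [p [m [pp m0 nE]]] [r [e [pr e0 FE]]].
have rp : r = p.
  apply/eqP; rewrite -(dvdn_prime2 pr pp).
  move: Fn; rewrite nE FE => /(dvdn_trans (dvdn_exp e0 (dvdnn r))).
  by rewrite Euclid_dvdX // => /andP[].
rewrite {r pr}rp in FE.
have pF : p \in [pchar F] by exact: card_finPcharP FE pp.
split.
  have p1 := prime_gt1 pp.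
  have [w wp] := prim_root_ex R[i] (prime_gt0 pp).
  (* ['F_p] is by definition ['Z_(pdiv p)], so the character lemmas are used at [pdiv p]; an
     additive surjection onto it carries the character over to [F]. *)
  have pd1 : (1 < pdiv p)%N by rewrite pdiv_id.
  have wd : (pdiv p).-primitive_root w by rewrite pdiv_id.
  have [||phi phiB phi_surj] := @additive_surjection p F 'F_p pF.
  - exact: pchar_Fp.
  - by rewrite card_Fp // FE -{1}[p]expn1 leq_pexp2l // ltnW.
  have phi0 : phi 0 = 0 by rewrite -[X in phi X](subrr 0) phiB subrr.
  have phiN x : phi (- x) = - phi x by rewrite -sub0r phiB phi0 sub0r.
  have phiD x y : phi (x + y) = phi x + phi y by rewrite -[y]opprK phiB !phiN.
  have [h hE] := phi_surj 1.
  apply: (quantum_coloring (chi := fun x => Zp_char w (phi x : 'Z_(pdiv p)))) => //.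
  - by rewrite phi0.
  - by move=> x y; rewrite phiD (Zp_charD pd1 wd).
  - by move=> x; rewrite phiN (Zp_char_conj pd1 wd).
  apply: (@sum_char0 _ _ (fun x => Zp_char w (phi x : 'Z_(pdiv p))) h).
    by move=> x y; rewrite phiD (Zp_charD pd1 wd).
  by rewrite hE (Zp_char_neq1 pd1 wd) ?oner_neq0.
move=> s; have [E pE Ecard] := pPrimePowerField pp m0.
have EF : (#|F| <= #|E|)%N by rewrite Ecard -nE dvdn_leq.
have [phi phiB phi_surj] := additive_surjection pE pF EF.
by rewrite nE -Ecard; apply: hadamard_clique phiB phi_surj.
Qed.

Local Close Scope ring_scope.

Theorem theorem1p3 (R : realType) (q : nat) (q_ge2 : (2 <= q)%N) :
  (exists N : nat, forall n : nat,
     (0 < n)%N -> (q %| n)%N -> ~~ odd (((q - 1) * n) %/ q) -> (N <= n)%N ->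
     is_quantum_chromatic_number R (@hadamard_graph 'Z_q n) n) /\
  (forall n : nat,
     (0 < n)%N -> (q %| n)%N -> prime_power n -> prime_power q ->
     forall F : finFieldType, #|F| = q ->
     is_quantum_chromatic_number R (@hadamard_graph F n) n).
Proof.
split; first exact: chromatic_Zq.
by move=> n n0 qn nP qP F Fq; apply: chromatic_Fq; rewrite ?Fq.
Qed.
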